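(* Let $n,d,u,c\ge 0$ be integers with $d+c+u+3\le n$. Consider repositories with $n$ packages and no known dependencies ($K=\emptyset$), with at most $d$ defects ($|D|\le d$), at most $u$ unknown dependencies ($|U|\le u$), and at most $c$ conflicts ($|C|\le c$). There exists a non-adaptive algorithm that solves Full Learning on all such repositories using $$\sum_{i=0}^{u}\mathcal S_{n,\,d+c+(u-i)+1,\,i+2}$$ queries.
   Context: A repository consists of a finite set $P$ of $n$ packages, a set $K\subseteq P\times P$ of known dependencies, a set $U\subseteq P\times P$ of unknown dependencies, a set $C$ of unknown conflicts (unordered pairs of distinct packages), and a set $D\subseteq P$ of defects. A dependency $(q,p)\in K\cup U$ means that $q$ depends on $p$. An installation is a subset $I\subseteq P$; it is successful iff (i) $I\cap D=\emptyset$, (ii) for every $(q,p)\in K\cup U$, $q\in I$ implies $p\in I$, and (iii) no $\{p,q\}\in C$ satisfies $p,q\in I$. A defect is a package contained in no successful installation, and $D$ is the set of all defects (so every package outside $D$ lies in some successful installation; in particular a package that depends on a defect, or on two conflicting packages, is a defect). Two packages $p,q$ weakly conflict if no successful installation includes both $p$ and $q$; $p$ weakly depends on $q$ if no successful installation includes $p$ but not $q$. An algorithm is given $P$, $K$ and the bounds $d,u,c$. A query is an installation $I\subseteq P$; the oracle answers whether $I$ is successful. A non-adaptive algorithm fixes its whole set of queries from its input alone, then computes its output from the answers. Local computation is free; the cost is the number of queries. ''Using $q$ queries'' means at most $q$ queries on every input. Full Learning (conflicts and dependencies understood in the weak sense): determine the set $D$ of defects, the set of all pairs of packages that weakly conflict,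 and the set of all ordered pairs $(p,q)$ such that $p$ weakly depends on $q$. For $a,b\ge 0$ with $a+b\le n$, an $(n,a,b)$-cover-free family (CFF) is a set $\mathcal F\subseteq\{0,1\}^n$ such that for all disjoint $S_1,S_2\subseteq\{1,\dots,n\}$ with $|S_1|=a$, $|S_2|=b$ there is $v\in\mathcal F$ with $v_i=0$ for all $i\in S_1$ and $v_i=1$ for all $i\in S_2$. $\mathcal S_{n,a,b}$ denotes the minimal size of an $(n,a,b)$-CFF. *)

(* Defs.v *)
From mathcomp Require Import all_boot.

Set Implicit Arguments.
Unset Strict Implicit.
Unset Printing Implicit Defensive.

Section Installations.

Variables (P : finType) (K U : {set P * P}) (C : {set {set P}}) (D : {set P}).

(* A pair (q, p) of K or U means that q depends on p; a conflict {p, q} is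
   the set [set p; q]. *)
Definition success (I : {set P}) : bool :=
  [&& [disjoint I & D],
      [forall e in K :|: U, (e.1 \in I) ==> (e.2 \in I)]
    & [forall e in C, ~~ (e \subset I)]].

End Installations.

(* The set D occurs in the definition of success and is itself characterized
   by it: repo_defectsP says that D is exactly the set of packages contained in
   no successful installation. *)
Record repository (P : finType) := Repository {
  known : {set P * P};
  unknown : {set P * P};
  conflicts : {set {set P}};
  defects : {set P};
  repo_conflictsP : forall e, e \in conflicts -> #|e| = 2;
  repo_defectsP : forall p, p \in defects <->
    ~ (exists2 I : {set P}, success known unknown conflicts defects I & p \in I)
}.

Section FullLearning.

Variables (P : finType) (R : repository P).

Definition successful (I : {set P}) : bool :=
  success (known R) (unknown R) (conflicts R) (defects R) I.

Definition weakly_conflict (p q : P) : bool :=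
  ~~ [exists I : {set P}, [&& successful I, p \in I & q \in I]].

Definition weakly_depends (p q : P) : bool :=
  ~~ [exists I : {set P}, [&& successful I, p \in I & q \notin I]].

(* As for conflicts, only two distinct packages form a pair. *)
Definition weak_conflicts : {set {set P}} :=
  [set [set e.1; e.2] | e : P * P & (e.1 != e.2) && weakly_conflict e.1 e.2].

Definition weak_dependencies : {set P * P} :=
  [set e : P * P | weakly_depends e.1 e.2].

Definition full_learning : {set P} * {set {set P}} * {set P * P} :=
  (defects R, weak_conflicts, weak_dependencies).

End FullLearning.

Record input (P : finType) := Input {
  input_known : {set P * P};
  defect_bound : nat;
  unknown_bound : nat;
  conflict_bound : nat
}.

(* Both the queries and the output may depend on the input. The answers to the
   queries are given as the set of those queries that are successful, so the
   output depends on the repository only through the answers. *)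
Record nonadaptive_algorithm (Out : finType -> Type) := NonadaptiveAlgorithm {
  queries : forall P : finType, input P -> {set {set P}};
  output : forall P : finType, input P -> {set {set P}} -> Out P
}.

Definition run (Out : finType -> Type) (A : nonadaptive_algorithm Out)
    (P : finType) (x : input P) (R : repository P) : Out P :=
  output A x [set I in queries A x | successful R I].

Definition full_learning_algorithm :=
  nonadaptive_algorithm
    (fun P : finType => ({set P} * {set {set P}} * {set P * P})%type).

(* The vectors of {0,1}^n are the functions 'I_n -> bool. *)
Definition cff (n a b : nat) (F : {set {ffun 'I_n -> bool}}) : bool :=
  [forall S1 : {set 'I_n}, forall S2 : {set 'I_n},
    [&& [disjoint S1 & S2], #|S1| == a & #|S2| == b] ==>
    [exists v in F, [forall i in S1, ~~ v i] && [forall i in S2, v i]]].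

(* The full set {0,1}^n is always a cover-free family (lemma cff_setT), hence
   the minimum ranges over a nonempty collection. *)
Definition cff_min (n a b : nat) : nat :=
  #|[arg min_(F < [set: {ffun 'I_n -> bool}] | cff a b F) #|F|]|.

Lemma cff_setT n a b : cff a b [set: {ffun 'I_n -> bool}].
Proof.
apply/forallP=> S1; apply/forallP=> S2; apply/implyP=> /and3P[dS _ _].
apply/existsP; exists [ffun i => i \in S2]; rewrite inE /=.
apply/andP; split; apply/forallP=> i; apply/implyP=> Si; rewrite ffunE //.
by rewrite (disjointFr dS Si).
Qed.

Lemma cff_minP n a b :
  (exists2 F : {set {ffun 'I_n -> bool}}, cff a b F & #|F| = cff_min n a b) /\
  (forall F : {set {ffun 'I_n -> bool}}, cff a b F -> cff_min n a b <= #|F|).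
Proof.
rewrite /cff_min; case: arg_minnP; first exact: cff_setT.
by move=> F cF minF; split; [exists F | exact: minF].
Qed.

(* Main.v *)
Require Import Defs.
From mathcomp Require Import all_boot.
From mathcomp Require Import zify.

(** Let J be a successful installation containing X and avoiding Y, where
    #|X| <= 2 and #|Y| <= 1, and let T be the closure of X under dependencies.
    Every package of T outside X is the target of a dependency with source in T,
    so if T adds j packages to X then at most u - j dependencies have their
    source outside T. A set that contains T and avoids the defects, one package
    outside T of each conflict, the sources outside T of dependencies, and Y is
    successful; this forces in at most j + 2 packages and out at most
    d + c + (u - j) + 1, so the j-th cover-free family contains such a set.
    Hence the successful queries already witness everything that Full Learning
    asks about successful installations. *)

Set Implicit Arguments.
Unset Strict Implicit.
Unset Printing Implicit Defensive.

(** * Hitting sets and dependency closures *)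

Lemma eq_imset_dom (aT rT : finType) (f : aT -> rT) (A B : {pred aT}) :
  A =i B -> f @: A = f @: B.
Proof.
move=> eqAB; apply/setP=> y.
by apply/imsetP/imsetP=> -[x Dx ->]; exists x; rewrite // ?eqAB // -eqAB.
Qed.

Lemma card_bigcup_leq (I : Type) (T : finType) (r : seq I) (A : pred I)
    (F : I -> {set T}) :
  #|\bigcup_(i <- r | A i) F i| <= \sum_(i <- r | A i) #|F i|.
Proof.
elim/big_rec2: _ => [|i n B _ leBn]; first by rewrite cards0.
by rewrite (leq_trans (leq_card_setU _ _)) // leq_add2l.
Qed.

(** Pick one point outside [A] from each member of [C]; the picked points number at most [#|C|].
    With [C] the conflicts, excluding them breaks every conflict without touching [A]. *)
Lemma hitting_setP (T : finType) (C : {set {set T}}) (A : {set T}) :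
  (forall e, e \in C -> ~~ (e \subset A)) ->
  exists H : {set T}, [/\ #|H| <= #|C|, [disjoint H & A]
    & forall e, e \in C -> exists2 x, x \in e & x \in H].
Proof.
move=> nsCA; pose f (e : {set T}) := [pick x in e :\: A].
exists [set x | Some x \in f @: C]; split.
- rewrite (leq_trans _ (leq_imset_card f C)) // -(card_imset _ (@Some_inj _)).
  by apply/subset_leq_card/subsetP=> _ /imsetP[x fx ->]; rewrite inE in fx.
- apply/pred0P=> x /=; rewrite inE; apply/negbTE/andP=> -[/imsetP[e _]].
  by rewrite /f; case: pickP => // y /setDP[_ /negP nAy] [->].
- move=> e Ce; have /subsetPn[y ey nAy] := nsCA e Ce.
  have [x fe]: exists x, f e = Some x.
    rewrite /f; case: pickP => [x _|/(_ y)]; first by exists x.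
    by rewrite inE ey nAy.
  exists x; last by rewrite inE -fe imset_f.
  by move: fe; rewrite /f; case: pickP => // z /setDP[ez _] [<-].
Qed.

(** Take a minimal closed set between [X] and [J], which exists because [J] itself is closed. By
    minimality each point added to [X] is the target of an edge with source in the closure, and
    distinct points need distinct edges. *)
Lemma dependency_closure (T : finType) (U : {set T * T}) (X J : {set T}) :
    X \subset J -> (forall e, e \in U -> e.1 \in J -> e.2 \in J) ->
  exists A : {set T}, [/\ X \subset A, A \subset J,
    forall e, e \in U -> e.1 \in A -> e.2 \in A
    & #|A :\: X| <= #|[set e in U | e.1 \in A]|].
Proof.
move=> sXJ clJ.
pose cl (A : {set T}) :=
  (X \subset A) && [forall e in U, (e.1 \in A) ==> (e.2 \in A)].
have clP (A : {set T}) : reflect (X \subset A /\ forall e, e \in U -> e.1 \in A -> e.2 \in A)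
    (cl A).
  apply: (iffP andP) => -[sXA clA]; split=> //.
    by move=> e Ue; move/forall_inP/(_ e Ue)/implyP: clA.
  by apply/forall_inP=> e Ue; apply/implyP/clA.
have [A minA sAJ] : {A | minset cl A & A \subset J}.
  by apply: minset_exists; apply/clP.
have /clP[sXA clA] := minsetp minA.
exists A; split=> //.
rewrite (leq_trans _ (leq_imset_card snd _)) //.
apply/subset_leq_card/subsetP=> t /setDP[At nXt]; apply: contraT => no_edge.
(* If no edge from [A] ends in [t], then [A] without [t] is still closed and still contains [X],
   against minimality. *)
have clAt: cl (A :\ t).
  apply/clP; split; first by rewrite subsetD1 sXA.
  move=> e Ue /setD1P[_ Ae1]; apply/setD1P; split; last exact: clA.
  apply: contra no_edge => /eqP <-.
  by apply: imset_f; rewrite inE Ue.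
have := minsetinf minA clAt (subD1set A t).
by move/setP/(_ t); rewrite !inE eqxx At.
Qed.

(** * Cover-free families for sets of bounded size *)

Lemma superset_card (T : finType) (A B : {set T}) k :
    A \subset B -> #|A| <= k <= #|B| ->
  exists S : {set T}, [/\ A \subset S, S \subset B & #|S| = k].
Proof.
move=> sAB /andP[leAk lekB].
have: k - #|A| <= #|B :\: A| by rewrite cardsDS //; lia.
case/card_geqP=> s [uniq_s size_s sBA].
exists (A :|: [set x in s]); split; first exact: subsetUl.
  rewrite subUset sAB; apply/subsetP=> x; rewrite inE => /sBA.
  by case/setDP.
rewrite cardsU cardsE (card_uniqP uniq_s) size_s.
have -> : A :&: [set x in s] = set0.
  apply/setP=> x; rewrite !inE; apply/negP=> /andP[Ax /sBA].
  by rewrite inE Ax.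
by rewrite cards0; lia.
Qed.

(** The definition of [cff] asks for exact sizes: pad [S1] to size [a] off [S2], then [S2] to size
    [b] off the padded [S1]. There is room since [a + b <= n]. *)
Lemma cff_leq n a b (F : {set {ffun 'I_n -> bool}}) (S1 S2 : {set 'I_n}) :
    cff a b F -> a + b <= n -> [disjoint S1 & S2] -> #|S1| <= a -> #|S2| <= b ->
  exists2 v, v \in F & (forall i, i \in S1 -> ~~ v i) /\
                       (forall i, i \in S2 -> v i).
Proof.
move=> cffF leabn dS leS1 leS2.
have := cardsC S2; rewrite card_ord => cS2.
have [||A [sS1A sAS2 cA]] := @superset_card _ S1 (~: S2) a.
- by rewrite -disjoints_subset.
- by lia.
have := cardsC A; rewrite card_ord => cA'.
have [||B [sS2B sBA cB]] := @superset_card _ S2 (~: A) b.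
- by rewrite -disjoints_subset disjoint_sym disjoints_subset.
- by lia.
move/forallP/(_ A)/forallP/(_ B)/implyP: cffF.
rewrite cA cB !eqxx disjoint_sym disjoints_subset sBA.
case/(_ isT)/existsP=> v /and3P[Fv /forall_inP v0 /forall_inP v1].
exists v => //; split=> i.
  by move/(subsetP sS1A)/v0.
by move/(subsetP sS2B)/v1.
Qed.

Definition optimal_cff n a b : {set {ffun 'I_n -> bool}} :=
  [arg min_(F < setT | cff a b F) #|F|].

Lemma optimal_cffP n a b : cff a b (optimal_cff n a b).
Proof. by rewrite /optimal_cff; case: arg_minnP; first exact: cff_setT. Qed.

(** * The algorithm and its correctness *)

Section Algorithm.

Variable P : finType.

Definition ffun_set (v : {ffun 'I_#|P| -> bool}) : {set P} :=
  [set p | v (enum_rank p)].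

Definition cff_queries (x : input P) : {set {set P}} :=
  let: Input _ d u c := x in
  \bigcup_(0 <= i < u.+1)
    ffun_set @: optimal_cff #|P| (d + c + (u - i) + 1) (i + 2).

(** This mirrors [full_learning], with the successful queries [S] in place of all successful
    installations. *)
Definition learned_output (S : {set {set P}}) :
    {set P} * {set {set P}} * {set P * P} :=
  (~: cover S,
   [set [set e.1; e.2] | e : P * P &
      (e.1 != e.2) && ~~ [exists I in S, (e.1 \in I) && (e.2 \in I)]],
   [set e : P * P | ~~ [exists I in S, (e.1 \in I) && (e.2 \notin I)]]).

Lemma card_cff_queries K d u c :
  #|cff_queries (Input K d u c)| <=
    \sum_(0 <= i < u.+1) cff_min #|P| (d + c + (u - i) + 1) (i + 2).
Proof.
rewrite (leq_trans (card_bigcup_leq _ _ _)) //; apply: leq_sum => i _.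
exact: leq_imset_card.
Qed.

Variables (R : repository P) (d u c : nat).
Hypotheses (hn : d + c + u + 3 <= #|P|) (known0 : known R = set0).
Hypotheses (leD : #|defects R| <= d) (leU : #|unknown R| <= u).
Hypothesis leC : #|conflicts R| <= c.

Lemma successfulP (I : {set P}) :
  reflect [/\ [disjoint I & defects R],
              forall e, e \in unknown R -> e.1 \in I -> e.2 \in I
            & forall e, e \in conflicts R -> ~~ (e \subset I)]
          (successful R I).
Proof.
rewrite /successful /success known0 set0U.
apply: (iffP and3P) => -[dI clI cI]; split=> //.
- by move=> e Ue; move/forall_inP/(_ e Ue)/implyP: clI.
- by move=> e Ce; move/forall_inP/(_ e Ce): cI.
- by apply/forall_inP=> e Ue; apply/implyP/clI.
- exact/forall_inP.
Qed.

(** The sizes 2 and 1 suit the three uses of the lemma: one package present (defects), two present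
    (conflicts), one present and one absent (dependencies). *)
Lemma successful_query (X Y J : {set P}) :
    successful R J -> X \subset J -> [disjoint Y & J] ->
    #|X| <= 2 -> #|Y| <= 1 ->
  exists2 I, I \in [set I in cff_queries (Input set0 d u c) | successful R I]
           & X \subset I /\ [disjoint Y & I].
Proof.
case/successfulP=> dJ clJ cJ sXJ dYJ leX leY.
have [T [sXT sTJ clT leT]] := dependency_closure sXJ clJ.
have [H [leH dHT hitH]] : exists H : {set P}, [/\ #|H| <= #|conflicts R|,
    [disjoint H & T] & forall e, e \in conflicts R -> exists2 x, x \in e & x \in H].
  by apply: hitting_setP => e Ce; apply: contra (cJ e Ce) => /subset_trans->.
pose out := [set e in unknown R | e.1 \notin T].
have cUT: #|[set e in unknown R | e.1 \in T]| + #|out| = #|unknown R|.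
  rewrite -(cardsID [set e | e.1 \in T] (unknown R)); congr (_ + _).
    by apply: eq_card => e; rewrite !inE.
  by apply: eq_card => e; rewrite !inE andbC.
pose S1 := defects R :|: H :|: (fst @: out) :|: Y.
have leS1: #|S1| <= d + c + #|out| + 1.
  rewrite (leq_trans (leq_card_setU _ _)) // leq_add //.
  rewrite (leq_trans (leq_card_setU _ _)) // leq_add ?leq_imset_card //.
  by rewrite (leq_trans (leq_card_setU _ _)) // leq_add // (leq_trans leH).
have dS1T: [disjoint S1 & T].
  rewrite disjoints_subset !subUset -!disjoints_subset dHT.
  rewrite disjoint_sym (disjointWl sTJ dJ) (disjointWr sTJ dYJ) andbT /=.
  apply/pred0P=> p /=; apply/negbTE/andP=> -[/imsetP[e]].
  by rewrite inE => /andP[_ /negP nTe] ->.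
have cTX := cardsDS sXT; have leXT := subset_leq_card sXT.
(* By [leT] and [cUT], [j + #|out| <= u]. Hence [u - j] is not truncated and bounds [#|out|], while
   [#|T| <= j + 2]. *)
pose j := #|T :\: X|.
have [v Fv [v0 v1]] : exists2 v,
    v \in optimal_cff #|P| (d + c + (u - j) + 1) (j + 2)
    & (forall i, i \in enum_rank @: S1 -> ~~ v i) /\
      (forall i, i \in enum_rank @: T -> v i).
  apply: cff_leq; first exact: optimal_cffP.
  (* As [j <= u], the two parameters add up to [d + c + u + 3], the left side of [hn]. *)
  - by rewrite /j; lia.
  - rewrite imset_disjoint //; exact: enum_rank_inj.
  - by rewrite card_imset; [rewrite /j; lia | exact: enum_rank_inj].
  - by rewrite card_imset; [rewrite /j; lia | exact: enum_rank_inj].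
have inI p : p \in T -> p \in ffun_set v.
  by move=> Tp; rewrite inE v1 ?imset_f.
have outI p : p \in S1 -> p \notin ffun_set v.
  by move=> S1p; rewrite inE v0 ?imset_f.
have disjI (A : {set P}) : A \subset S1 -> [disjoint A & ffun_set v].
  move=> sAS; apply/pred0P=> p /=; apply/negbTE/andP=> -[Ap].
  by apply/negP/outI/(subsetP sAS).
exists (ffun_set v); last first.
  split; last by apply: disjI; rewrite subsetUr.
  by apply/subsetP=> p /(subsetP sXT)/inI.
rewrite inE; apply/andP; split.
  rewrite /cff_queries big_mkord; apply/bigcupP.
  have ltju: j < u.+1 by rewrite /j; lia.
  by exists (Ordinal ltju) => //; apply: imset_f.
apply/successfulP; split.
- by rewrite disjoint_sym disjI // /S1 -!setUA subsetUl.
(* The query may contain packages outside [T], but none of them is the source of a dependency, as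
   such sources lie in [S1]. *)
- move=> e Ue Ie; have [Te|nTe] := boolP (e.1 \in T); first exact/inI/clT.
  have: e.1 \notin ffun_set v; last by rewrite Ie.
  apply: outI; rewrite /S1 !inE; apply/orP; left; apply/orP; right.
  by apply: imset_f; rewrite inE Ue.
- move=> e /hitH[p ep Hp]; apply/subsetPn; exists p => //.
  by apply: outI; rewrite /S1 !inE Hp orbT.
Qed.

(** Every successful query is a successful installation; conversely [successful_query] replaces a
    witness [J] by a query that agrees with it on the packages in question. *)
Lemma learned_outputP :
  learned_output [set I in cff_queries (Input set0 d u c) | successful R I]
    = full_learning R.
Proof.
set S := [set I in _ | _].
have succS I : I \in S -> successful R I by rewrite inE => /andP[].
rewrite /learned_output /full_learning; congr (_, _, _).
- apply/setP=> p; rewrite inE; apply/negP/idP.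
    move=> ncov; apply/repo_defectsP=> -[J sJ Jp]; apply: ncov.
    have [||||I SI [sXI _]] := @successful_query [set p] set0 J sJ.
    + by rewrite sub1set.
    + by rewrite disjoints_subset sub0set.
    + by rewrite cards1.
    + by rewrite cards0.
    by apply/bigcupP; exists I => //; rewrite -sub1set.
  move/repo_defectsP=> nJ /bigcupP[I /succS sI Ip].
  by apply: nJ; exists I.
- apply: eq_imset_dom => -[p q]; rewrite !inE /=; congr (_ && ~~ _).
  apply/existsP/existsP=> [[I /andP[/succS sI pqI]]|[J /and3P[sJ Jp Jq]]].
    by exists I; rewrite sI.
  have [||||I SI [sXI _]] := @successful_query [set p; q] set0 J sJ.
  + by rewrite subUset !sub1set Jp.
  + by rewrite disjoints_subset sub0set.
  (* The test that [p] and [q] differ was split off by [congr], so the pair may be a singleton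
     here. *)
  + by rewrite cards2; case: (_ != _).
  + by rewrite cards0.
  by exists I; rewrite SI -!sub1set -subUset.
- apply/setP=> -[p q]; rewrite !inE /=; congr (~~ _).
  apply/existsP/existsP=> [[I /andP[/succS sI pqI]]|[J /and3P[sJ Jp nJq]]].
    by exists I; rewrite sI.
  have [||||I SI [sXI dYI]] := @successful_query [set p] [set q] J sJ.
  + by rewrite sub1set.
  + by rewrite disjoints1.
  + by rewrite cards1.
  + by rewrite cards1.
  by exists I; rewrite SI -sub1set sXI -disjoints1.
Qed.

End Algorithm.

Theorem theorem14 (n d u c : nat) (hn : d + c + u + 3 <= n) :
  exists A : full_learning_algorithm,
    forall P : finType, #|P| = n ->
      let x : input P := Input set0 d u c in
      #|queries A x| <= \sum_(0 <= i < u.+1) cff_min n (d + c + (u - i) + 1) (i + 2)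
      /\ forall R : repository P,
           known R = set0 ->
           #|defects R| <= d ->
           #|unknown R| <= u ->
           #|conflicts R| <= c ->
           run A x R = full_learning R.
Proof.
exists (NonadaptiveAlgorithm cff_queries
  (fun P (_ : input P) => @learned_output P)) => P cardP x.
rewrite -cardP in hn *; split; first exact: card_cff_queries.
by move=> R K0 leD leU leC; apply: learned_outputP.
Qed.
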